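(* For any integer $k\ge 1$, one has $\pi_k(X)\ge \frac{1}{\sqrt[3]{4}\,\sqrt{k}}\,X^{1/6}$ for all sufficiently large $X$.
   Context: An integer $n$ is called a rational cube sum if there exist rational numbers $\alpha,\beta\in\mathbb{Q}$ with $n=\alpha^3+\beta^3$. For a fixed integer $k\ge 0$, $\pi_k(X)=\#\{n\in\mathbb{N} : n\le X \text{ and both } n \text{ and } n+k \text{ are rational cube sums}\}$. *)

(* Defs.v *)
From HB Require Import structures.
From mathcomp Require Import all_boot all_order all_algebra finmap.
From mathcomp Require Import all_classical all_reals all_analysis.

Set Implicit Arguments.
Unset Strict Implicit.
Unset Printing Implicit Defensive.

Import Order.TTheory GRing.Theory Num.Theory.
Import numFieldNormedType.Exports.

Local Open Scope classical_set_scope.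
Local Open Scope ring_scope.

Definition rational_cube_sum (n : int) : Prop :=
  exists a b : rat, n%:~R = a ^+ 3 + b ^+ 3.

(* The natural numbers start at 1 here: n = 0 is not counted. *)
Definition cube_sum_pairs (R : realType) (k : nat) (X : R) : set nat :=
  [set n : nat | [/\ (0 < n)%N, n%:R <= X,
     rational_cube_sum n%:Z & rational_cube_sum (n + k)%N%:Z]].

(* [fset_set] is [fset0] on infinite sets, hence the need for this lemma. *)
Lemma finite_cube_sum_pairs (R : realType) (k : nat) (X : R) :
  finite_set (cube_sum_pairs k X).
Proof.
apply: (sub_finite_set _ (finite_II (Num.truncn X).+1)).
move=> n [_ nX _ _] /=; rewrite ltnS -(@natrK R n).
exact: le_truncn.
Qed.

Definition cube_sum_count (R : realType) (k : nat) (X : R) : nat :=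
  #|` fset_set (cube_sum_pairs k X)|%fset.

(* Main.v *)
Require Import Defs.
From HB Require Import structures.
From mathcomp Require Import all_boot all_order all_algebra finmap.
From mathcomp Require Import all_classical all_reals all_analysis.
From mathcomp Require Import zify ring lra.

Import Order.TTheory GRing.Theory Num.Theory.
Import numFieldNormedType.Exports.

Local Open Scope classical_set_scope.
Local Open Scope ring_scope.

(** The curve [x^3 + y^3 = N] is 3-isogenous to the curve [u v (u + v) = N],
    and the isogeny is explicit:
      [(u^3 + 6 u^2 v + 3 u v^2 - v^3)^3 + (v^3 + 6 u v^2 + 3 u^2 v - u^3)^3
         = u v (u + v) (3 (u^2 + u v + v^2))^3].
    Hence every integer of the form [u v (u + v) / c^3] is a rational cube sum
    ([rational_cube_sum_of_product]).

    The number [16 k^3 t^6 = 2 (2 k t^2)^3] is a sum of two equal cubes, and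
    [16 k^3 t^6 - k = u v (u + v) / (2 t)^3] with [u = 4 k t^3 - 1] and
    [v = 4 k t^3 + 1]. So [n = 16 k^3 t^6 - k] is counted for every [t >= 1],
    and [n <= X] as soon as [t <= c X^(1/6)], where [c = 1 / (4^(1/3) sqrt k)]
    satisfies [16 k^3 c^6 = 1]. This gives [floor (c X^(1/6))] values of [n].

    One more value makes up for the rounding. Since [w (w + 1)] and
    [w (w + 8) = 8 w (w + 8) / 2^3] are always rational cube sums,
    [n = (k + 15) (k + 16)], for which [n + k = (k + 12) (k + 20)], is counted
    too, and it is not in the family above ([sporadic_notin_family]). *)

Lemma PoszX (m n : nat) : (m ^ n)%N%:Z = m%:Z ^+ n.
Proof. by rewrite -natz natrX natz. Qed.

Lemma rational_cube_sum_of_product (N c u v : int) :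
  c != 0 -> u != 0 -> N * c ^+ 3 = u * v * (u + v) -> rational_cube_sum N.
Proof.
move=> c0 u0 /(congr1 (fun z : int => z%:~R : rat)).
rewrite rmorphM rmorphXn !rmorphM rmorphD /=.
have : (c%:~R : rat) != 0 by rewrite intr_eq0.
have : (u%:~R : rat) != 0 by rewrite intr_eq0.
rewrite /rational_cube_sum.
move: (N%:~R : rat) (c%:~R : rat) (u%:~R : rat) (v%:~R : rat).
move=> {N c u v c0 u0} N c u v u0 c0 NE.
have q0 : u ^+ 2 + u * v + v ^+ 2 != 0.
  (* [u^2 + u v + v^2 = 3/4 u^2 + (u/2 + v)^2] *)
  have u2 : 0 < u ^+ 2 by rewrite exprn_even_gt0.
  have w2 := sqr_ge0 (u / 2 + v).
  by apply: lt0r_neq0; lra.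
pose q := 3 * (u ^+ 2 + u * v + v ^+ 2) * c.
exists ((u ^+ 3 + 6 * u ^+ 2 * v + 3 * u * v ^+ 2 - v ^+ 3) / q).
exists ((v ^+ 3 + 6 * u * v ^+ 2 + 3 * u ^+ 2 * v - u ^+ 3) / q).
have -> : N = u * v * (u + v) / c ^+ 3 by rewrite -NE mulfK// expf_neq0.
by rewrite /q; field; rewrite c0 q0.
Qed.

Lemma rational_cube_sum_double_cube (a : int) : rational_cube_sum (2 * a ^+ 3).
Proof. by exists a%:~R, a%:~R; rewrite rmorphM rmorphXn /=; ring. Qed.

Lemma family_gt (k t : nat) : (0 < k)%N -> (0 < t)%N ->
  (k < 16 * k ^ 3 * t ^ 6)%N.
Proof.
move=> k0 t0; have : (0 < k ^ 2 * t ^ 6)%N by rewrite muln_gt0 !expn_gt0 k0 t0.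
by nia.
Qed.

Lemma rational_cube_sum_family (k t : nat) : (0 < k)%N -> (0 < t)%N ->
  rational_cube_sum (16 * k ^ 3 * t ^ 6 - k)%N%:Z.
Proof.
move=> k0 t0.
have le_k := ltnW (@family_gt k t k0 t0).
apply: (@rational_cube_sum_of_product _ (2 * t%:Z)
  (4 * k%:Z * t%:Z ^+ 3 - 1) (4 * k%:Z * t%:Z ^+ 3 + 1)).
- by lia.
- have : (0 < k * t ^ 3)%N by rewrite muln_gt0 expn_gt0 k0 t0.
  by rewrite -mulrA -PoszX -PoszM; lia.
- by rewrite -subzn// 2!PoszM !PoszX; ring.
Qed.

Lemma rational_cube_sum_step1 (w : nat) : rational_cube_sum (w * (w + 1))%N%:Z.
Proof.
apply: (@rational_cube_sum_of_product _ 1 1 w%:Z) => //.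
by rewrite PoszM PoszD; ring.
Qed.

Lemma rational_cube_sum_step8 (w : nat) : rational_cube_sum (w * (w + 8))%N%:Z.
Proof.
apply: (@rational_cube_sum_of_product _ 2 8 w%:Z) => //.
by rewrite PoszM PoszD; ring.
Qed.

Lemma sporadic_notin_family (k t : nat) : (0 < k)%N -> (0 < t)%N ->
  ((k + 15) * (k + 16) != 16 * k ^ 3 * t ^ 6 - k)%N.
Proof.
move=> k0 t0; have t6 : (0 < t ^ 6)%N by rewrite expn_gt0 t0.
apply/eqP; move: (t ^ 6)%N t6 => T T0.
have -> : (k ^ 3 = k * k * k)%N by rewrite !expnS expn0; lia.
(* The family is too large when [k >= 4]; divisibility by 16 excludes
   [k = 1, 2, 3]. *)
have [k4|k4] := leqP 4 k; last first.
  have [->|[->|->]] : (k = 1 \/ k = 2 \/ k = 3)%N by lia.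
  - by lia.
  - by lia.
  - by lia.
have : (k * k * k <= k * k * k * T)%N by rewrite leq_pmulr.
by nia.
Qed.

Lemma family_inj (k : nat) : (0 < k)%N ->
  {in [pred t | 0 < t]%N &, injective (fun t => 16 * k ^ 3 * t ^ 6 - k)%N}.
Proof.
move=> k0 s t; rewrite !inE => s0 t0 st.
have le_k r r0 := ltnW (@family_gt k r k0 r0).
have /eqP : (16 * k ^ 3 * s ^ 6 = 16 * k ^ 3 * t ^ 6)%N.
  by rewrite -(subnK (le_k _ s0)) st subnK// le_k.
by rewrite eqn_pmul2l ?muln_gt0 ?expn_gt0 ?k0// eqn_exp2r// => /eqP.
Qed.

Lemma size_le_cube_sum_count (R : realType) (k : nat) (X : R) (s : seq nat) :
  uniq s -> (forall n, n \in s -> cube_sum_pairs k X n) ->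
  (size s <= cube_sum_count k X)%N.
Proof.
move=> us sP; apply: uniq_leq_size => // n /sP nP.
by rewrite in_fset_set ?inE//; exact: finite_cube_sum_pairs.
Qed.

(** The constant is the sixth root of the inverse of [16 k^3]. *)
Lemma constant_exp6 (R : realType) (k : nat) (X : R) : (0 < k)%N -> 0 <= X ->
  16 * k%:R ^+ 3 * (1 / (4 `^ (1 / 3) * Num.sqrt k%:R) * X `^ (1 / 6)) ^+ 6 = X.
Proof.
move=> k0 X0.
have E4 : ((4 : R) `^ (1 / 3)) ^+ 6 = 16.
  rewrite -powR_mulrn ?powR_ge0// -powRrM (_ : 1 / 3 * 6 = 2%:R); last by field.
  by rewrite powR_mulrn//; ring.
have EX : (X `^ (1 / 6)) ^+ 6 = X.
  rewrite -powR_mulrn ?powR_ge0// -powRrM (_ : 1 / 6 * 6 = 1); last by field.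
  by rewrite powRr1.
have Ek : Num.sqrt (k%:R : R) ^+ 6 = k%:R ^+ 3.
  by rewrite (exprM _ 2 3) sqr_sqrtr.
rewrite exprMn EX expr_div_n exprMn E4 Ek expr1n.
by field; rewrite pnatr_eq0 -lt0n.
Qed.

Theorem proposition1p21 (R : realType) (k : nat) (hk : (1 <= k)%N) :
  \forall X \near (+oo : set_system R),
    1 / (4 `^ (1 / 3) * Num.sqrt k%:R) * X `^ (1 / 6)
      <= (cube_sum_count k X)%:R.
Proof.
near=> X.
have leX : ((k + 15) * (k + 16))%N%:R <= X by near: X; exact: nbhs_pinfty_ge.
have X0 : 0 <= X by apply: le_trans leX.
have := @constant_exp6 R k X hk X0.
set Y := (X in X <= _) => YE.
have Y0 : 0 <= Y by rewrite /Y mulr_ge0 ?powR_ge0// divr_ge0// mulr_ge0 ?powR_ge0.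
have /andP[leY ltY] := truncn_itv Y0.
apply: (le_trans (ltW ltY)); rewrite ler_nat.
pose f t := (16 * k ^ 3 * t ^ 6 - k)%N.
pose s := ((k + 15) * (k + 16))%N :: [seq f t | t <- iota 1 (Num.truncn Y)].
have -> : (Num.truncn Y).+1 = size s by rewrite /= size_map size_iota.
apply: size_le_cube_sum_count.
- rewrite /s /=; apply/andP; split.
    apply/mapP => -[t]; rewrite mem_iota => /andP[t0 _] /eqP.
    by rewrite (negbTE (@sporadic_notin_family k t hk t0)).
  rewrite map_inj_in_uniq ?iota_uniq// => t u.
  rewrite !mem_iota => /andP[t0 _] /andP[u0 _].
  exact: family_inj.
move=> n; rewrite inE => /orP[/eqP ->|/mapP[t]].
  split=> //.
  - by rewrite muln_gt0 !addn_gt0 !orbT.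
  - have -> : (k + 16 = k + 15 + 1)%N by lia.
    exact: rational_cube_sum_step1.
  - have -> : ((k + 15) * (k + 16) + k = (k + 12) * (k + 12 + 8))%N by lia.
    exact: rational_cube_sum_step8.
rewrite mem_iota add1n ltnS => /andP[t0 tY] ->{n}.
have lt_k := @family_gt k t hk t0.
split.
- by rewrite subn_gt0.
- apply: (@le_trans _ _ (16 * k ^ 3 * t ^ 6)%N%:R).
    by rewrite ler_nat leq_subr.
  rewrite 2!natrM !natrX -[leRHS]YE ler_wpM2l ?mulr_ge0 ?exprn_ge0//.
  by rewrite lerXn2r ?nnegrE//; apply: le_trans leY; rewrite ler_nat.
- exact: rational_cube_sum_family.
- rewrite subnK 1?ltnW// (_ : Posz _ = 2 * (2 * k%:Z * t%:Z ^+ 2) ^+ 3).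
    exact: rational_cube_sum_double_cube.
  by rewrite 2!PoszM !PoszX; ring.
Unshelve. all: by end_near.
Qed.
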